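(* Let $\mathfrak D$ be a decomposable pseudodistance on $\mathcal P\otimes\mathcal P^+$ with components $\mathfrak D^0,\mathfrak D^1,\rho_\theta$. Then the minimum pseudodistance estimator $$\theta_{\mathfrak D,n}=\mathrm{argmin}_\theta\left[\mathfrak D^0(P_\theta)+\frac1n\sum_{i=1}^n\rho_\theta(X_i)\right]$$ is Fisher consistent in the sense that $$T_{\mathfrak D}(P_{\theta_0})=\mathrm{argmin}_\theta\,\mathfrak D(P_\theta,P_{\theta_0})=\theta_0\quad\text{for all }\theta_0\in\Theta .$$
   Context: $(\mathcal X,\mathcal A)$ is a measurable space, $\Theta\subset\mathbb R^d$, $\mathcal P=\{P_\theta:\theta\in\Theta\}$ is an identifiable family of mutually equivalent nonatomic probability measures on it dominated by a $\sigma$-finite measure; $P_0\notin\mathcal P$ is a probability measure equivalent with the members of $\mathcal P$; $\mathcal P^+=\mathcal P\cup\{P_0\}$; $\mathcal P_{\rm emp}$ is the set of empirical measures $P_n=\frac1n\sum_{i=1}^n\delta_{X_i}$; $\mathcal Q=\mathcal P^+\cup\mathcal P_{\rm emp}$; $Q\cdot f=\int f\,\mathrm dQ$. A pseudodistance is a map $\mathfrak D:\mathcal P\otimes\mathcal P^+\to\mathbb R$ such that $\mathfrak D(P_\theta,P_{\tilde\theta})\ge0$ for all $\theta,\tilde\theta\in\Theta$, with $\mathfrak D(P_\theta,P_{\tilde\theta})=0$ iff $\theta=\tilde\theta$. It is decomposable if there exist functionals $\mathfrak D^0:\mathcal P\to\mathbb R$, $\mathfrak D^1:\mathcal P^+\to\mathbb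 R$ and measurable mappings $\rho_\theta:\mathcal X\to\mathbb R$, $\theta\in\Theta$, such that for all $\theta\in\Theta$, $Q\in\mathcal P^+$ the expectations $Q\cdot\rho_\theta$ exist and $\mathfrak D(P_\theta,Q)=\mathfrak D^0(P_\theta)+\mathfrak D^1(Q)+Q\cdot\rho_\theta$. The functional $T_{\mathfrak D}$ is defined by $T_{\mathfrak D}(Q)=\mathrm{argmin}_\theta[\mathfrak D^0(P_\theta)+Q\cdot\rho_\theta]$ for $Q\in\mathcal Q$, and $\theta_{\mathfrak D,n}=T_{\mathfrak D}(P_n)$. *)

(* Defs.v *)
From HB Require Import structures.
From mathcomp Require Import all_boot all_order all_algebra.
From mathcomp Require Import all_classical all_reals all_analysis.

Set Implicit Arguments.
Unset Strict Implicit.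
Unset Printing Implicit Defensive.
Import Order.TTheory GRing.Theory Num.Theory.
Import numFieldNormedType.Exports.

Local Open Scope classical_set_scope.
Local Open Scope ring_scope.

(* The argmin is the set of all minimizers; "argmin f = a" is read
   [argmin D f = [set a]]: [a] is a minimizer over [D] and the only one. *)
Definition argmin (T : Type) (R : realType) (D : set T) (f : T -> R) : set T :=
  [set a | D a /\ forall b, D b -> f a <= f b].

Section measures.
Context {disp : measure_display} {X : measurableType disp} {R : realType}.
Implicit Types Q : probability X R.

(* Equality of measures on the sigma-algebra. Leibniz equality of the
   underlying set functions would also compare values on nonmeasurable sets. *)
Definition same_measure Q1 Q2 : Prop :=
  forall A : set X, measurable A -> Q1 A = Q2 A.

Definition equivalent_measures Q1 Q2 : Prop := Q1 `<< Q2 /\ Q2 `<< Q1.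

Definition atom Q (A : set X) : Prop :=
  [/\ measurable A, (0 < Q A)%E &
      forall B : set X, measurable B -> B `<=` A -> Q B = 0%E \/ Q B = Q A].

Definition nonatomic Q : Prop := forall A : set X, ~ atom Q A.

End measures.

(* The empirical measure of the n.+1 observations x 0, ..., x n; the shift
   keeps sample sizes positive. *)
Section empirical.
Context {disp : measure_display} {X : measurableType disp} {R : realType}.
Variables (x : nat -> X) (n : nat).

Definition empirical : set X -> \bar R :=
  mscale (n.+1%:R^-1 : R)%:nng (msum (fun i => \d_(x i)) n.+1).

HB.instance Definition _ := Measure.on empirical.

Let empirical_setT : empirical setT = 1%E.
Proof.
rewrite /empirical /mscale/= /msum.
rewrite (eq_bigr (fun=> 1%E)) => [|i _]; last exact: diracT.
by rewrite sumEFin sumr_const card_ord -EFinM mulVf.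
Qed.

HB.instance Definition _ :=
  Measure_isProbability.Build _ _ _ empirical empirical_setT.

End empirical.
Arguments empirical {disp X} R x n.

(* [P] is a total function, but only its restriction to [Theta] is ever
   constrained or used. *)
Section model.
Context {disp : measure_display} {X : measurableType disp} {R : realType}.
Context {d : nat}.
Variables (Theta : set 'rV[R]_d) (P : 'rV[R]_d -> probability X R).

Definition identifiable : Prop :=
  forall t1 t2, Theta t1 -> Theta t2 -> same_measure (P t1) (P t2) -> t1 = t2.

Definition mutually_equivalent : Prop :=
  forall t1 t2, Theta t1 -> Theta t2 -> equivalent_measures (P t1) (P t2).

Definition sigma_finitely_dominated : Prop :=
  exists lambda : {measure set X -> \bar R},
    sigma_finite setT lambda /\ forall t, Theta t -> P t `<< lambda.

Definition family_plus (P0 : probability X R) : set (probability X R) :=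
  (P @` Theta) `|` [set P0].

(* A pseudodistance and its components are represented by total functions on
   probability measures; their values outside the family (resp. the enlarged
   family) play no role. *)
Definition pseudodistance (D : probability X R -> probability X R -> R) :
    Prop :=
  forall t t', Theta t -> Theta t' ->
    0 <= D (P t) (P t') /\ (D (P t) (P t') = 0 <-> t = t').

(* [D], being real-valued, forces the expectations to be finite. *)
Definition decomposition (P0 : probability X R)
    (D : probability X R -> probability X R -> R)
    (D0 D1 : probability X R -> R) (rho : 'rV[R]_d -> X -> R) : Prop :=
  (forall t, Theta t -> measurable_fun setT (rho t)) /\
  (forall t Q, Theta t -> family_plus P0 Q ->
    Q.-integrable setT (EFin \o rho t) /\
    D (P t) Q = D0 (P t) + D1 Q + \int[Q]_x rho t x).

Definition T_functional (D0 : probability X R -> R)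
    (rho : 'rV[R]_d -> X -> R) (Q : probability X R) : set 'rV[R]_d :=
  argmin Theta (fun t => D0 (P t) + \int[Q]_x rho t x).

Definition min_pseudodistance_estimator (D0 : probability X R -> R)
    (rho : 'rV[R]_d -> X -> R) (x : nat -> X) (n : nat) : set 'rV[R]_d :=
  T_functional D0 rho (empirical R x n).

End model.

(* Main.v *)
Require Import Defs.
From mathcomp Require Import all_boot all_order all_algebra.
From mathcomp Require Import all_classical all_reals all_analysis.
From mathcomp Require Import measurable_realfun.
Import Order.TTheory GRing.Theory Num.Theory.
Import numFieldNormedType.Exports.
Local Open Scope classical_set_scope.
Local Open Scope ring_scope.

(** Fisher consistency holds because, on the model, decomposability separates
    the part of [D (P t) Q] that depends on [t] from the part that depends on
    [Q] alone: at [Q = P t0] the criterion [D0 (P t) + \int[Q]_x rho t x] is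
    [D (P t) Q] shifted by the constant [- D1 Q], and a shift by a constant
    leaves the set of minimizers unchanged ([eq_argmin_addr]).  What is left to
    minimize is [t |-> D (P t) (P t0)], which is nonnegative on the parameter
    set and vanishes exactly at [t0], so that [t0] is its only minimizer
    ([argmin_unique_zero]).

    That the estimator is the minimizer of the sample criterion amounts to the
    fact that integration against the empirical measure is averaging over the
    observations ([Rintegral_empirical]), because a point mass integrates every
    measurable function to its value at the point. *)

(** Nonnegative integrands come first because linearity of the integral in the
    measure (scaling and finite sums) then needs no integrability argument;
    each Dirac mass contributes one value of [g]. *)
Lemma ge0_integral_empirical (disp : measure_display)
    (X : measurableType disp) (R : realType) (x : nat -> X) (n : nat)
    (g : X -> R) :
  measurable_fun setT g -> (forall y, 0 <= g y) ->
  (\int[empirical R x n]_y (g y)%:E =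
     (n.+1%:R^-1 * \sum_(i < n.+1) g (x i))%:E)%E.
Proof.
move=> /measurable_EFinP mEg g0.
have Eg0 y : setT y -> (0 <= (g y)%:E)%E by rewrite lee_fin.
rewrite /empirical ge0_integral_mscale// ge0_integral_measure_sum//= EFinM.
congr (_ * _)%E; rewrite -sumEFin; apply: eq_bigr => i _.
by rewrite integral_dirac// diracT mul1e.
Qed.

(** The positive and negative parts are averaged separately; both averages are
    finite, so the difference of the two integrals is never indeterminate. *)
Lemma Rintegral_empirical (disp : measure_display)
    (X : measurableType disp) (R : realType) (x : nat -> X) (n : nat)
    (f : X -> R) :
  measurable_fun setT f ->
  \int[empirical R x n]_y f y = n.+1%:R^-1 * \sum_(i < n.+1) f (x i).
Proof.
move=> mf; rewrite /Rintegral integralE -/(EFin \o f) funerpos funerneg.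
rewrite !ge0_integral_empirical//; first last.
- exact: measurable_funrpos.
- exact: measurable_funrneg.
rewrite -EFinB /= -mulrBr -sumrB; congr (_ * _).
by apply: eq_bigr => i _; rewrite -[in RHS](funrposBneg f).
Qed.

(** With [c] the value of [- D1] at the true distribution, this is why [D1] can
    be absent from the criterion defining the estimator. *)
Lemma eq_argmin_addr (T : Type) (R : realType) (A : set T) (f g : T -> R)
    (c : R) :
  (forall a, A a -> f a = g a + c) -> argmin A f = argmin A g.
Proof.
move=> fgc; apply/seteqP; split=> a [Aa amin]; split=> // b Ab.
- by rewrite -(lerD2r c) -!fgc//; exact: amin.
- by rewrite !fgc// lerD2r; exact: amin.
Qed.

(** A minimizer does at least as well as [a0], where [f] is zero, so by
    nonnegativity its value is zero too, and only [a0] has that value. *)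
Lemma argmin_unique_zero (T : Type) (R : realType) (A : set T) (f : T -> R)
    (a0 : T) :
  A a0 -> (forall a, A a -> 0 <= f a /\ (f a = 0 <-> a = a0)) ->
  argmin A f = [set a0].
Proof.
move=> Aa0 f0; have [_ [_ /(_ erefl) fa0]] := f0 _ Aa0.
apply/seteqP; split=> [a [Aa amin]|_ ->].
  have [fa_ge0 [fa_inj _]] := f0 _ Aa.
  by apply: fa_inj; apply/le_anti; rewrite fa_ge0 -fa0 amin.
by split=> // b Ab; rewrite fa0; have [] := f0 _ Ab.
Qed.

Theorem theorem3p1 (disp : measure_display) (X : measurableType disp)
    (R : realType) (d : nat) (Theta : set 'rV[R]_d)
    (P : 'rV[R]_d -> probability X R) (P0 : probability X R)
    (P_identifiable : identifiable Theta P)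
    (P_equivalent : mutually_equivalent Theta P)
    (P_nonatomic : forall t, Theta t -> nonatomic (P t))
    (P_dominated : sigma_finitely_dominated Theta P)
    (P0_notin : forall t, Theta t -> ~ same_measure P0 (P t))
    (P0_equivalent : forall t, Theta t -> equivalent_measures P0 (P t))
    (D : probability X R -> probability X R -> R)
    (D0 D1 : probability X R -> R) (rho : 'rV[R]_d -> X -> R)
    (D_pseudodistance : pseudodistance Theta P D)
    (D_decomposable : decomposition Theta P P0 D D0 D1 rho) :
  (forall (x : nat -> X) (n : nat),
     min_pseudodistance_estimator Theta P D0 rho x n =
     argmin Theta
       (fun t => D0 (P t) + n.+1%:R^-1 * \sum_(i < n.+1) rho t (x i))) /\
  (forall t0, Theta t0 ->
     T_functional Theta P D0 rho (P t0) =
       argmin Theta (fun t => D (P t) (P t0)) /\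
     argmin Theta (fun t => D (P t) (P t0)) = [set t0]).
Proof.
have [mrho Ddec] := D_decomposable.
split=> [x n|t0 Tt0].
  apply: (@eq_argmin_addr _ _ _ _ _ 0) => t Tt.
  by rewrite addr0 Rintegral_empirical//; exact: mrho.
split.
  apply: (@eq_argmin_addr _ _ _ _ _ (- D1 (P t0))) => t Tt.
  have [_ ->] := Ddec t (P t0) Tt (or_introl (imageP P Tt0)).
  by rewrite addrAC addrK.
apply: argmin_unique_zero => // t Tt; exact: D_pseudodistance.
Qed.
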